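(* Let $F:\mathbb{R}^n\times\mathbb{R}\times\mathbb{R}^n\times\mathcal{S}^n\to\mathbb{R}$ satisfy: (i) (degenerate ellipticity) $F(x,u,p,X)\ge F(x,v,p,Y)$ whenever $x,p\in\mathbb{R}^n$, $u\ge v$ and $X\le Y$; (ii) $-F(x,0,p,X)\le \phi(|p|)-\mathcal{P}^-_{\lambda,\Lambda}(X)$ for all $x,p\in\mathbb{R}^n$, $X\in\mathcal{S}^n$, where $0<\lambda\le\Lambda$ and $\phi:[0,\infty)\to[0,\infty)$ is a strictly increasing continuous function with $\phi(t)\ge t$ for all $t\geq 0$ and $\int_0^1\frac{dt}{\phi(t)}=\infty$. Let $\Omega\subset\mathbb{R}^n$ be an open connected set and suppose that $u$ is a viscosity subsolution of $F(x,u,Du,D^2u)=0$ in $\Omega$. If $u$ attains a positive maximum in $\Omega$, then $u$ is constant.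
   Context: $\mathcal{S}^n$ is the set of symmetric $n\times n$ real matrices with the positive semi-definite ordering. For $X\in\mathcal{S}^n$ with eigenvalues $e_1,\dots,e_n$, $\mathcal{P}^-_{\lambda,\Lambda}(X):=-\Lambda\sum_{e_i\ge0}e_i-\lambda\sum_{e_i<0}e_i$. An upper semicontinuous function $u:\Omega\to\mathbb{R}$ is a viscosity subsolution of $F(x,u,Du,D^2u)=0$ in $\Omega$ if for every $\varphi\in C^2(\Omega)$ and every $x_0\in\Omega$ at which $u-\varphi$ has a local maximum, $F(x_0,u(x_0),D\varphi(x_0),D^2\varphi(x_0))\le0$. *)

(* Defs.v *)
From HB Require Import structures.
From mathcomp Require Import all_boot all_order all_algebra.
From mathcomp Require Import all_classical all_reals all_analysis.

Set Implicit Arguments.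
Unset Strict Implicit.
Unset Printing Implicit Defensive.

Import Order.TTheory GRing.Theory Num.Theory.
Import numFieldNormedType.Exports.

Local Open Scope classical_set_scope.
Local Open Scope ring_scope.

(* Points of R^n are row vectors; functions on an open set
   [Omega] are total functions of which only the values on [Omega] matter. *)

(* The canonical norm on ['rV[R]_n] is the sup norm; the topology is the same. *)
Definition enorm (R : realType) (n : nat) (p : 'rV[R]_n) : R :=
  Num.sqrt (\sum_(i < n) p 0 i ^+ 2).

Definition psd_le (R : realType) (n : nat) (X Y : 'M[R]_n) : Prop :=
  forall v : 'rV[R]_n, 0 <= (v *m (Y - X) *m v^T) 0 0.

(* The eigenvalues listed with multiplicity. Such a list exists for symmetric
   [X] and is unique up to permutation; [[::]] is returned when the
   characteristic polynomial does not split over [R]. *)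
Definition eigenvalues (R : realType) (n : nat) (X : 'M[R]_n) : seq R :=
  xget [::] [set s : seq R | char_poly X = \prod_(e <- s) ('X - e%:P)].

Definition pucci_minus (R : realType) (lambda Lambda : R) (n : nat)
    (X : 'M[R]_n) : R :=
  - Lambda * (\sum_(e <- eigenvalues X | 0 <= e) e)
  - lambda * (\sum_(e <- eigenvalues X | e < 0) e).

Definition partial (R : realType) (n : nat) (i : 'I_n) (f : 'rV[R]_n -> R) :
    'rV[R]_n -> R :=
  fun x => 'D_(delta_mx 0 i) f x.

Definition grad (R : realType) (n : nat) (f : 'rV[R]_n -> R)
    (x : 'rV[R]_n) : 'rV[R]_n :=
  \row_(i < n) partial i f x.

Definition hessian (R : realType) (n : nat) (f : 'rV[R]_n -> R)
    (x : 'rV[R]_n) : 'M[R]_n :=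
  \matrix_(i < n, j < n) partial j (partial i f) x.

(* [Omega] is meant to be open, so that continuity and derivatives at its points
   do not depend on the values of [f] outside. *)
Definition C0_on (R : realType) (n : nat) (Omega : set 'rV[R]_n)
    (f : 'rV[R]_n -> R) : Prop :=
  forall x, Omega x -> {for x, continuous f}.

Definition C1_on (R : realType) (n : nat) (Omega : set 'rV[R]_n)
    (f : 'rV[R]_n -> R) : Prop :=
  [/\ C0_on Omega f,
      forall (i : 'I_n) x, Omega x -> derivable f x (delta_mx 0 i) &
      forall i : 'I_n, C0_on Omega (partial i f)].

Definition C2_on (R : realType) (n : nat) (Omega : set 'rV[R]_n)
    (f : 'rV[R]_n -> R) : Prop :=
  C1_on Omega f /\ forall i : 'I_n, C1_on Omega (partial i f).

Definition usc_on (R : realType) (n : nat) (Omega : set 'rV[R]_n)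
    (u : 'rV[R]_n -> R) : Prop :=
  forall x, Omega x -> forall a : R, u x < a ->
    \forall y \near x, Omega y -> u y < a.

Definition local_max_on (R : realType) (n : nat) (Omega : set 'rV[R]_n)
    (f : 'rV[R]_n -> R) (x0 : 'rV[R]_n) : Prop :=
  \forall y \near x0, Omega y -> f y <= f x0.

(* The last argument of [F] ranges over all matrices, but the assumptions on
   [F] concern symmetric ones only, and the Hessian of a [C^2] function is
   symmetric, so only the restriction of [F] to symmetric matrices matters. *)
Definition degenerate_elliptic (R : realType) (n : nat)
    (F : 'rV[R]_n -> R -> 'rV[R]_n -> 'M[R]_n -> R) : Prop :=
  forall (x p : 'rV[R]_n) (r s : R) (X Y : 'M[R]_n),
    X \is symmetricmx -> Y \is symmetricmx ->
    s <= r -> psd_le X Y -> F x s p Y <= F x r p X.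

Definition viscosity_subsolution (R : realType) (n : nat)
    (F : 'rV[R]_n -> R -> 'rV[R]_n -> 'M[R]_n -> R) (Omega : set 'rV[R]_n)
    (u : 'rV[R]_n -> R) : Prop :=
  usc_on Omega u /\
  forall (f : 'rV[R]_n -> R) (x0 : 'rV[R]_n),
    C2_on Omega f -> Omega x0 ->
    local_max_on Omega (fun x => u x - f x) x0 ->
    F x0 (u x0) (grad f x0) (hessian f x0) <= 0.

(* Main.v *)
Require Import Defs.
From HB Require Import structures.
From mathcomp Require Import all_boot all_order all_algebra.
From mathcomp Require Import ring lra.
From mathcomp Require Import all_classical all_reals all_analysis.

(* Let M be the maximum and suppose u(y) < M for some y close to a point x1 with
   u(x1) = M. In terms of s = |x - y|^2 the barrier v = G(s) is built from a
   positive solution H of H' = - K phi(H), with G' proportional to H: the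
   Osgood condition says exactly that such a solution never reaches 0, and it
   tends to 0 at infinity, so v can be made arbitrarily flat. Since phi(t) >= t,
   for K large the second derivative of G beats both the tangential eigenvalues
   of D^2 v and phi(|Dv|), i.e. v is a strict supersolution on an annulus around
   y. Normalised by v(x1) = M, v lies above u on the inner sphere (v is flat and
   u < M near y) and on the outer one (v > M), so u - v has an interior maximum,
   where u >= v > 0, which contradicts the subsolution property. *)

Set Implicit Arguments.
Unset Strict Implicit.
Unset Printing Implicit Defensive.

Import Order.TTheory GRing.Theory Num.Theory.
Import numFieldNormedType.Exports.

Local Open Scope classical_set_scope.
Local Open Scope ring_scope.

(** * One-variable calculus *)

Lemma is_derive_integral (R : realType) (f : R -> R) (a b x : R) :
  a < x -> x < b -> {within `[a, b], continuous f} ->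
  is_derive x 1 (fun y => \int[lebesgue_measure]_(t in `[a, y]) f t) (f x).
Proof.
move=> ax xb cf.
have fi : lebesgue_measure.-integrable `[a, b] (EFin \o f).
  by apply: continuous_compact_integrable => //; exact: segment_compact.
have cfx : {for x, continuous f}.
  have /continuous_within_itvP[//|cf' _ _] := cf; first exact: lt_trans xb.
  by apply: cf'; rewrite in_itv/= ax xb.
have [dF F'] := continuous_FTC1_closed xb fi ax cfx.
apply: DeriveDef; first exact: dF.
by rewrite -derive1E; exact: F'.
Qed.

Lemma continuous_in_within (R : realType) (f : R -> R) (i : interval R) :
  (forall x, x \in i -> {for x, continuous f}) ->
  {within [set` i], continuous f}.
Proof.
by move=> cf; apply: continuous_in_subspaceT => x; rewrite inE => /cf.
Qed.

Lemma is_derive_continuous (R : realType) (f : R -> R) (x d : R) :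
  is_derive x 1 f d -> {for x, continuous f}.
Proof.
by move=> df; apply/differentiable_continuous/derivable1_diffP; exact: ex_derive.
Qed.

Lemma is_derive_affine (R : realType) (a b x : R) :
  is_derive x 1 (fun t : R => a * t + b) a.
Proof.
have -> : (fun t : R => a * t + b) = a *: id + cst b by [].
by apply: is_derive_eq; rewrite addr0 [_ *: _]mulr1.
Qed.

(** * The Osgood condition and the equation [T' = - phi(T)] *)

(* p(t) = - P(1 - t) with P(x) = \int_{-1}^x dt / phi(1 - t): the reflection puts
   the singularity of 1 / phi at the upper end, since the fundamental theorem
   is only available for integrals with a variable upper bound. *)
Lemma osgood_primitive (R : realType) (phi : R -> R) :
  (forall t : R, 0 < t -> 0 < phi t) ->
  (forall t : R, 0 < t -> {for t, continuous phi}) ->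
  (\int[lebesgue_measure]_(t in `]0%R, 1%R]) ((phi t)^-1)%:E = +oo)%E ->
  exists p : R -> R,
    (forall t : R, 0 < t -> t < 2 -> is_derive t 1 p (phi t)^-1) /\
    (forall B, exists t, [/\ 0 < t, t < 1 & p t < B]).
Proof.
move=> phi_gt0 cphi phi_oo.
have cV t : 0 < t -> {for t, continuous (fun t => (phi t)^-1)}.
  by move=> t0; apply: (cvgV _ (cphi _ t0)); rewrite gt_eqF// phi_gt0.
pose P x : R := \int[lebesgue_measure]_(t in `[-1, x]) (phi (1 - t))^-1.
have dP (x : R) : -1 < x -> x < 1 -> is_derive x 1 P (phi (1 - x))^-1.
  (* The midpoint [b] of [x] and 1 keeps [x] interior while staying away from the singularity at
     1. *)
  move=> x1 x2; pose b := (x + 1) / 2.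
  apply: (@is_derive_integral _ (fun t => (phi (1 - t))^-1) (-1) b) => //.
    by rewrite /b; lra.
  apply: continuous_in_within => t; rewrite in_itv/= => /andP[t1 t2].
  apply: (@continuous_comp _ _ _ (fun t : R => 1 - t) (fun t => (phi t)^-1)).
    by apply: continuousB; [exact: cst_continuous|exact: cvg_id].
  by apply: cV; rewrite /b in t2; lra.
exists (fun t => - P (1 - t)).
have dp (t : R) : 0 < t -> t < 2 -> is_derive t 1 (fun t => - P (1 - t)) (phi t)^-1.
  move=> t0 t2.
  have d1 : is_derive (1 - t) 1 P (phi t)^-1.
    by rewrite -[in phi t](subKr 1 t); apply: dP; lra.
  have d2 : is_derive t 1 (fun t => 1 - t) (-1 : R).
    by rewrite -(sub0r 1); apply: is_deriveB.
  have d3 := @is_derive1_comp _ P (fun t : R => 1 - t) t _ _ d1 d2.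
  have d4 := @is_deriveN _ _ _ _ _ _ _ d3.
  by rewrite mulrN1 opprK in d4.
(* If [p] were at least [B] on ]0, 1[, every integral of [1 / phi] over [a, 1] would be at most
   [p 1 - B], and monotone convergence would contradict the divergence. *)
split => // B; apply: contrapT => nB.
set p := (fun t => _) in dp nB.
have pB t : 0 < t -> t < 1 -> B <= p t.
  by move=> t0 t1; rewrite leNgt; apply/negP => ptB; apply: nB; exists t.
have int_le a : 0 < a -> a < 1 ->
  (\int[lebesgue_measure]_(t in `[a, 1%R]) ((phi t)^-1)%:E <= (p 1 - B)%:E)%E.
  move=> a0 a1.
  rewrite (@continuous_FTC2 _ (fun t => (phi t)^-1) p)//.
  - by rewrite -EFinB lee_fin lerB// pB.
  - apply: continuous_in_within => t; rewrite in_itv/= => /andP[ta _].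
    by apply: cV; exact: lt_le_trans ta.
  - split.
    + move=> t; rewrite in_itv/= => /andP[ta tb].
      by have := dp t; case=> //; lra.
    + apply: cvg_at_right_filter.
      by apply: is_derive_continuous (dp a _ _); lra.
    + apply: cvg_at_left_filter.
      by apply: is_derive_continuous (dp 1 _ _); lra.
  - move=> t; rewrite in_itv/= => /andP[ta tb].
    by rewrite derive1E; have := dp t; case=> //; lra.
(* The shift by 2 makes every left end strictly smaller than 1, as [int_le] requires. *)
pose F (k : nat) : set R := `[k.+2%:R^-1, 1%R]%classic.
have F_bigcup : \bigcup_k F k = `]0%R, 1%R]%classic.
  apply/seteqP; split => x /=.
    move=> [k _]; rewrite /F/= !in_itv/= => /andP[xk ->]; rewrite andbT.
    by apply: lt_le_trans xk; rewrite invr_gt0.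
  rewrite in_itv/= => /andP[x0 x1].
  have [k kx] := ltr_add_invr x0.
  exists k => //; rewrite /F/= in_itv/= x1 andbT ltW//.
  move: kx; rewrite add0r; apply: le_lt_trans.
  by rewrite lef_pV2 ?posrE// ler_nat.
have : (\int[lebesgue_measure]_(t in \bigcup_k F k) ((phi t)^-1)%:E
   <= (p 1 - B)%:E)%E.
  have int_cvg : (\int[lebesgue_measure]_(t in F k) ((phi t)^-1)%:E @[k --> \oo]
      --> \int[lebesgue_measure]_(t in \bigcup_k F k) ((phi t)^-1)%:E)%E.
    apply: ge0_nondecreasing_set_cvg_integral.
    - move=> k l kl; rewrite subsetEset => x; rewrite /F/= !in_itv/=.
      move=> /andP[kx ->]; rewrite andbT; apply: le_trans kx.
      by rewrite lef_pV2 ?posrE// ler_nat.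
    - by move=> k; exact: measurable_itv.
    - move=> k.
      have : lebesgue_measure.-integrable (F k)
          (EFin \o (fun t : R => (phi t)^-1)).
        apply: continuous_compact_integrable; first exact: segment_compact.
        apply: continuous_in_within => t; rewrite in_itv/= => /andP[kt _].
        by apply: cV; apply: lt_le_trans kt; rewrite invr_gt0.
      exact: measurable_int.
    - move=> k x; rewrite /F/= in_itv/= => /andP[kx _].
      rewrite lee_fin invr_ge0 ltW// phi_gt0//.
      by apply: lt_le_trans kx; rewrite invr_gt0.
  rewrite -(cvg_lim _ int_cvg)//; apply: lime_le.
    by apply/cvg_ex; eexists; exact: int_cvg.
  near=> k; apply: int_le; first by rewrite invr_gt0.
  by rewrite invf_lt1// ltr1n.
by rewrite F_bigcup phi_oo.
Unshelve. all: by end_near. Qed.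

Lemma gt0_is_derive_lt (R : realType) (f df : R -> R) (a b : R) :
  (forall x, a < x -> x < b -> is_derive x 1 f (df x) /\ 0 < df x) ->
  forall x y, a < x -> x < y -> y < b -> f x < f y.
Proof.
move=> fdf x y ax xy yb.
have [z||z] := @MVT _ f df _ _ xy.
- rewrite in_itv/= => /andP[xz zy].
  by apply: (fdf _ _ _).1; [exact: lt_trans xz|exact: lt_trans yb].
- apply: continuous_in_within => z; rewrite in_itv/= => /andP[xz zy].
  apply: is_derive_continuous (fdf _ _ _).1.
    exact: lt_le_trans xz.
  exact: le_lt_trans yb.
rewrite in_itv/= => /andP[xz zy]; rewrite -(subr_gt0 (f x)) => ->.
rewrite mulr_gt0 ?subr_gt0//; apply: (fdf _ _ _).2.
  exact: lt_trans xz.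
exact: lt_trans yb.
Qed.

(* T inverts - p for a primitive p of 1 / phi; A is a primitive of T. *)
Lemma osgood_ode (R : realType) (phi : R -> R) :
  (forall t : R, 0 < t -> 0 < phi t) ->
  (forall t : R, 0 < t -> {for t, continuous phi}) ->
  (\int[lebesgue_measure]_(t in `]0%R, 1%R]) ((phi t)^-1)%:E = +oo)%E ->
  exists T A : R -> R, exists c : R,
    (forall t, c < t -> [/\ 0 < T t, is_derive t 1 T (- phi (T t)) &
                            is_derive t 1 A (T t)]) /\
    (forall e, 0 < e -> exists2 d, c < d & forall t, d <= t -> T t < e).
Proof.
move=> phi_gt0 cphi phi_oo.
have [p [dp pNoo]] := osgood_primitive phi_gt0 cphi phi_oo.
have p_lt : forall x y : R, 0 < x -> x < y -> y < 2 -> p x < p y.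
  apply: (@gt0_is_derive_lt _ p (fun t => (phi t)^-1)) => x x0 x2.
  by split; [exact: dp|rewrite invr_gt0 phi_gt0].
pose T (t : R) : R := xget 1 [set x | [/\ 0 < x, x < 1 & p x = - t]].
pose c := - p (1 / 2).
have TP t : c < t -> [/\ 0 < T t, T t < 1 & p (T t) = - t].
  move=> ct; rewrite /T; case: xgetP => [x _ //|nT]; exfalso.
  have [x [x0 x1 pxt]] := pNoo (- t).
  have x2 : x < 1 / 2.
    rewrite ltNge; apply/negP; rewrite le_eqVlt => /predU1P[xE|x2].
      by move: pxt; rewrite -xE /c in ct *; lra.
    by have := p_lt (1 / 2) x; rewrite /c in ct; lra.
  have [|||y] := @IVT _ p x (1 / 2) (- t).
  - exact: ltW.
  - apply: continuous_in_within => y; rewrite in_itv/= => /andP[xy yx].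
    by apply: is_derive_continuous (dp _ _ _); lra.
  - rewrite ge_min le_max (ltW pxt)/=; apply/orP; right.
    by rewrite /c in ct; lra.
  rewrite in_itv/= => /andP[xy yx] pyt.
  by apply: (nT y); split => //; lra.
have TK x : 0 < x -> x < 1 -> T (- p x) = x.
  move=> x0 x1; rewrite /T; case: xgetP => [y _ [y0 y1]|nT]; last first.
    by exfalso; apply: (nT x); split; rewrite ?opprK.
  rewrite opprK => pxy; case: (ltgtP x y) => // xy.
    by have := p_lt x y; lra.
  by have := p_lt y x; lra.
(* Derivative of an inverse function: [- p] has derivative [- 1 / phi], whose reciprocal at [T t] is
   [- phi (T t)]. *)
have dT t : c < t -> is_derive t 1 T (- phi (T t)).
  move=> ct; have [T0 T1 pT] := TP t ct.
  have dNp : is_derive (T t) 1 (- p) (- (phi (T t))^-1).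
    by apply: is_deriveN; apply: dp; lra.
  have near_T : \forall x \near T t, 0 < x < 1.
    near=> x; apply/andP; split; near: x; [exact: lt_nbhsr|exact: lt_nbhsl].
  have : is_derive ((- p) (T t)) 1 T (- (phi (T t))^-1)^-1.
    apply: is_derive_inverse dNp _.
    - by apply: filterS near_T => x /andP[x0 x1]; exact: TK.
    - apply: filterS near_T => x /andP[x0 x1].
      apply: is_derive_continuous; apply: is_deriveN; apply: dp; lra.
    - by rewrite oppr_eq0 invr_eq0 gt_eqF// phi_gt0.
  by rewrite invrN invrK; rewrite /GRing.opp/= pT opprK.
(* Integrating from [c + 1] keeps the closed interval of integration inside the region [t > c] where
   [T] is continuous; hence the returned threshold [c + 1]. *)
exists T, (fun y => \int[lebesgue_measure]_(t in `[c + 1, y]) T t), (c + 1).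
split=> [t ct|e e0].
  have ct' : c < t by lra.
  have [T0 T1 pT] := TP t ct'.
  split => //; first exact: dT.
  apply: (@is_derive_integral _ T (c + 1) (t + 1)) => //; first lra.
  apply: continuous_in_within => x; rewrite in_itv/= => /andP[cx _].
  by apply: is_derive_continuous (dT _ _); lra.
(* [e'] lies below 1, where [p] is strictly increasing: once [t > - p e'], the equation
   [p (T t) = - t < p e'] forces [T t <= e']. *)
pose e' := Num.min e 1 / 2.
have e'P : [/\ 0 < e', e' < 1 & e' < e].
  by rewrite /e' minEle; case: ifP => h; split; lra.
exists (Num.max c (- p e') + 2) => [|t dt].
  by have : c <= Num.max c (- p e') by [rewrite le_max lexx]; lra.
have h1 : c <= Num.max c (- p e') by rewrite le_max lexx.
have h2 : - p e' <= Num.max c (- p e') by rewrite le_max lexx orbT.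
have [|T0 T1 pT] := TP t; first lra.
case: e'P => e1 e2 e3; apply: le_lt_trans e3; rewrite leNgt; apply/negP => eT.
by have := p_lt e' (T t); lra.
Unshelve. all: by end_near. Qed.

(** * The Pucci operator on a scalar matrix plus a rank-one matrix *)

(* Both sides are c times the determinant of the block matrix [1, v; u, c]. *)
Lemma det_scalar_sub_rank1 (R : comNzRingType) (n : nat) (c : R)
    (u : 'cV[R]_n) (v : 'rV[R]_n) :
  c * \det (c%:M - u *m v) = (c - (v *m u) 0 0) * c ^+ n.
Proof.
pose M := block_mx (1%:M : 'M[R]_1) v u (c%:M : 'M[R]_n).
have dM : \det M = \det (c%:M - u *m v).
  have E : M *m block_mx 1%:M (- v) 0 1%:M = block_mx 1%:M 0 u (c%:M - u *m v).
    rewrite mulmx_block !mul1mx !mulmx1 !mulmx0 !addr0 addNr mulmxN.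
    by rewrite [- _ + _]addrC.
  move/(congr1 determinant): E; rewrite det_mulmx det_ublock det_lblock.
  by rewrite !det1 !mulr1 !mul1r.
have E : M *m block_mx c%:M 0 (- u) 1%:M = block_mx (c%:M - v *m u) v 0 c%:M.
  rewrite mulmx_block !mul1mx !mulmx1 !mulmx0 !add0r !mulmxN.
  by rewrite mul_mx_scalar mul_scalar_mx subrr.
move/(congr1 determinant): E; rewrite det_mulmx det_lblock det_ublock.
rewrite !det1 !det_scalar mulr1 expr1.
by rewrite dM [_ * c]mulrC => ->; congr (_ * _); rewrite det_mx11 !mxE mulr1n.
Qed.

(** The characteristic matrix is [('X - a) I] minus a rank-one product, so the determinant identity
    applies after multiplying by the nonzero factor ['X - a], which is cancelled. *)
Lemma char_poly_scalar_rank1 (R : idomainType) (m : nat) (a b : R)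
    (w : 'rV[R]_m.+1) :
  char_poly (a%:M + b *: (w^T *m w)) =
  \prod_(e <- rcons (nseq m a) (a + b * (w *m w^T) 0 0)) ('X - e%:P).
Proof.
set s := (w *m w^T) 0 0.
have XaN0 : 'X - a%:P != 0 :> {poly R} by rewrite polyXsubC_eq0.
apply: (mulfI XaN0).
rewrite /char_poly; set M := char_poly_mx _.
have -> : M = ('X - a%:P)%:M - (b%:P *: map_mx polyC w^T) *m map_mx polyC w.
  apply/matrixP => i j; rewrite !mxE !big_ord_recl !big_ord0.
  rewrite !mxE !addr0 rmorphD rmorphMn rmorphM/= rmorphM/= mulrA.
  by case: eqP => _; rewrite ?mulr1n ?mulr0n; ring.
rewrite det_scalar_sub_rank1 -scalemxAr -map_mxM.
rewrite -cats1 big_cat/= big_seq1 mxE [_ 0 0]mxE -/s.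
rewrite (_ : \prod_(e <- nseq m a) _ = ('X - a%:P) ^+ m); last first.
  by rewrite big_nseq iter_mulr_1.
rewrite rmorphD rmorphM/= exprS; ring.
Qed.

(** Roots of a split polynomial are unique up to order, so sums over the chosen list can be computed
    on any explicit factorisation. *)
Lemma eigenvalues_perm (R : realType) (n : nat) (X : 'M[R]_n) (s : seq R) :
  char_poly X = \prod_(e <- s) ('X - e%:P) -> perm_eq (eigenvalues X) s.
Proof.
move=> Xs; rewrite /eigenvalues; case: xgetP => [t _ Xt|/(_ s)//].
by apply: prod_XsubC_eq; rewrite -Xt.
Qed.

(** This is the sign pattern of the Hessian of the barrier: [m] nonnegative tangential eigenvalues
    and one negative radial eigenvalue. *)
Lemma pucci_minus_rank1 (R : realType) (lambda Lambda : R) (m : nat) (a b : R)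
    (w : 'rV[R]_m.+1) :
  0 <= a -> a + b * (w *m w^T) 0 0 < 0 ->
  pucci_minus lambda Lambda (a%:M + b *: (w^T *m w)) =
  - (Lambda * a *+ m) - lambda * (a + b * (w *m w^T) 0 0).
Proof.
move=> a0 ab0; have pE := eigenvalues_perm (char_poly_scalar_rank1 a b w).
rewrite /pucci_minus !(perm_big _ pE)/= -!cats1 !big_cat/= !big_cons !big_nil.
rewrite leNgt ab0/= !addr0.
have -> : \sum_(e <- nseq m a | e < 0) e = 0.
  apply: big1_seq => x /andP[x0]; rewrite mem_nseq => /andP[_ /eqP xa].
  by rewrite xa ltNge a0 in x0.
have -> : \sum_(e <- nseq m a | 0 <= e) e = a *+ m.
  transitivity (\sum_(e <- nseq m a) e); last by rewrite big_nseq iter_addr addr0.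
  rewrite big_seq_cond [RHS]big_seq; apply: eq_bigl => x .
  rewrite mem_nseq; case: (x =P a) => [->|_].
    by rewrite a0 andbT.
  by rewrite andbF.
by rewrite add0r mulNr mulrnAr.
Qed.

Lemma symmetric_scalar_rank1 (R : fieldType) (n : nat) (a b : R)
    (w : 'rV[R]_n) : a%:M + b *: (w^T *m w) \is symmetricmx.
Proof.
rewrite is_hermitianmxE expr0 scale1r map_mx_id//; apply/eqP/matrixP => i j.
by rewrite !mxE !big_ord1 !mxE eq_sym [w 0 i * _]mulrC.
Qed.

(** * Squared distance and directional derivatives *)

(** The square of the Euclidean distance is smooth at [y] too, so the barrier is an admissible test
    function on all of [Omega], centre included. *)
Definition sqdist (R : realType) (n : nat) (y x : 'rV[R]_n) : R :=
  \sum_(i < n) (x 0 i - y 0 i) ^+ 2.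

(** Restricting to a line makes the one-variable chain rule available for directional derivatives,
    without total differentiability of [f]. *)
Lemma is_derive_lineP (R : realType) (V : normedModType R) (f : V -> R)
    (x v : V) (d : R) :
  is_derive x v f d <-> is_derive (0 : R) 1 (fun h : R => f (h *: v + x)) d.
Proof.
have E : 'D_v f x = 'D_1 (fun h : R => f (h *: v + x)) 0.
  rewrite /derive.
  set g := (g in _ = lim (g @ _)); suff -> : g = (fun h : R =>
    h^-1 *: ((f \o shift x) (h *: v) - f x)) by [].
  by apply/funext => h; rewrite /g/= addr0 scale0r add0r [h *: 1]mulr1.
split=> -[df dE]; (apply: DeriveDef; last by rewrite -?E// E).
  by move/derivable1P : df.
by apply/derivable1P.
Qed.

Lemma is_derive_comp (R : realType) (V : normedModType R) (f : V -> R)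
    (g : R -> R) (x v : V) (df dg : R) :
  is_derive x v f df -> is_derive (f x) 1 g dg ->
  is_derive x v (fun z => g (f z)) (dg * df).
Proof.
move=> /is_derive_lineP fl gl; apply/is_derive_lineP.
apply: (@is_derive1_comp _ g (fun h : R => f (h *: v + x))).
by rewrite scale0r add0r.
Qed.

Lemma is_derive_coord (R : realType) (n : nat) (x v : 'rV[R]_n) (i : 'I_n) :
  is_derive x v (fun z : 'rV[R]_n => z 0 i) (v 0 i).
Proof.
apply/is_derive_lineP.
have -> : (fun h : R => (h *: v + x) 0 i) = (v 0 i *: id + cst (x 0 i)).
  by apply/funext => h; rewrite !mxE/= mulrC.
by apply: is_derive_eq; rewrite addr0 [_ *: _]mulr1.
Qed.

Lemma is_derive_sqdist (R : realType) (n : nat) (y x v : 'rV[R]_n) :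
  is_derive x v (sqdist y) (\sum_(i < n) 2 * (x 0 i - y 0 i) * v 0 i).
Proof.
have -> : sqdist y = \sum_(i < n) (fun x : 'rV[R]_n => (x 0 i - y 0 i) ^+ 2).
  by apply/funext => z; rewrite fct_sumE.
apply: is_derive_sum => i.
apply: (@is_derive_comp _ _ (fun x : 'rV[R]_n => x 0 i) (fun t => (t - y 0 i) ^+ 2)).
  exact: is_derive_coord.
have -> : (fun t : R => (t - y 0 i) ^+ 2) = (id - cst (y 0 i)) ^+ 2 by [].
by apply: is_derive_eq; rewrite /= !subr0 [_ *: _]mulr1 expr1 mulr_natl.
Qed.

Lemma sqdist_continuous (R : realType) (n : nat) (y : 'rV[R]_n) :
  continuous (sqdist y).
Proof.
rewrite /sqdist; apply: continuous_big => [|i _ x]; first exact: add_continuous.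
have h : {for x, continuous (fun z : 'rV[R]_n => z 0 i - y 0 i)}.
  by apply: continuousB; [exact: coord_continuous|exact: cst_continuous].
exact: (cvgM h h).
Qed.

Lemma sqdist_ge0 (R : realType) (n : nat) (y x : 'rV[R]_n) : 0 <= sqdist y x.
Proof. by apply: sumr_ge0 => i _; exact: sqr_ge0. Qed.

(** * Gradient, Hessian and regularity of radial functions *)

Section radial.
Variables (R : realType) (n : nat) (y : 'rV[R]_n) (G G' G'' : R -> R).
Hypothesis dG : forall t : R, 0 <= t -> is_derive t 1 G (G' t).
Hypothesis dG' : forall t : R, 0 <= t -> is_derive t 1 G' (G'' t).
Hypothesis cG'' : forall t : R, 0 <= t -> {for t, continuous G''}.

Let f (x : 'rV[R]_n) := G (sqdist y x).

Lemma is_derive_radial (i : 'I_n) (g : R -> R) (dg : R) (x : 'rV[R]_n) :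
  is_derive (sqdist y x) 1 g dg ->
  is_derive x (delta_mx 0 i) (fun x => g (sqdist y x))
    (dg * (2 * (x 0 i - y 0 i))).
Proof.
move=> dg'; have := is_derive_comp (is_derive_sqdist y x (delta_mx 0 i)) dg'.
rewrite (bigD1 i)//= big1 ?addr0 ?mxE ?eqxx ?mulr1// => j ji.
by rewrite mxE eqxx (negbTE ji) mulr0.
Qed.

Lemma partial_radial (i : 'I_n) :
  partial i f = fun x => G' (sqdist y x) * (2 * (x 0 i - y 0 i)).
Proof.
apply/funext => x; rewrite /partial.
by have [] := is_derive_radial i (dG (sqdist_ge0 y x)).
Qed.

Lemma is_derive_partial_radial (i j : 'I_n) (x : 'rV[R]_n) :
  is_derive x (delta_mx 0 j) (partial i f)
    (2 * G' (sqdist y x) *+ (i == j) +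
     4 * G'' (sqdist y x) * ((x 0 i - y 0 i) * (x 0 j - y 0 j))).
Proof.
rewrite partial_radial.
have d1 := is_derive_radial j (dG' (sqdist_ge0 y x)).
have d2 : is_derive x (delta_mx 0 j) (fun x : 'rV[R]_n => 2 * (x 0 i - y 0 i))
   (2 * (i == j)%:R).
  apply: (@is_derive_comp _ _ (fun x : 'rV[R]_n => x 0 i) (fun t => 2 * (t - y 0 i))).
    by have := is_derive_coord x (delta_mx 0 j) i; rewrite mxE eqxx.
  have -> : (fun t : R => 2 * (t - y 0 i)) = 2 *: (id - cst (y 0 i)) by [].
  by apply: is_derive_eq; rewrite subr0 [_ *: _]mulr1.
apply: is_derive_eq; rewrite /GRing.scale/=.
by case: (i == j); rewrite ?mulr1n ?mulr0n; ring.
Qed.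

Lemma grad_radial (x : 'rV[R]_n) :
  grad f x = (2 * G' (sqdist y x)) *: (x - y).
Proof. by apply/rowP => i; rewrite !mxE partial_radial; ring. Qed.

Lemma hessian_radial (x : 'rV[R]_n) :
  hessian f x =
  (2 * G' (sqdist y x))%:M + (4 * G'' (sqdist y x)) *: ((x - y)^T *m (x - y)).
Proof.
apply/matrixP => i j; rewrite !mxE big_ord1 !mxE /partial.
by have [_ ->] := is_derive_partial_radial i j x.
Qed.

Lemma continuous_comp_sqdist (g : R -> R) (x : 'rV[R]_n) :
  {for sqdist y x, continuous g} -> {for x, continuous (fun x => g (sqdist y x))}.
Proof.
move=> cg; apply: (@continuous_comp _ _ _ (sqdist y) g) => //.
exact: sqdist_continuous.
Qed.

Lemma C2_radial (Omega : set 'rV[R]_n) : C2_on Omega f.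
Proof.
have ccoord (x : 'rV[R]_n) i : {for x, continuous (fun x : 'rV[R]_n => x 0 i - y 0 i)}.
  by apply: continuousB; [exact: coord_continuous|exact: cst_continuous].
have cG'_radial (i : 'I_n) : C0_on Omega (partial i f).
  move=> x _; rewrite partial_radial.
  apply: (@continuousM _ _ (fun x => G' (sqdist y x))).
    exact: continuous_comp_sqdist (is_derive_continuous (dG' (sqdist_ge0 y x))).
  by apply: (@continuousM _ _ (cst 2)); [exact: cst_continuous|exact: ccoord].
split; last move=> i.
  split=> // [x _|i x _].
    exact: continuous_comp_sqdist (is_derive_continuous (dG (sqdist_ge0 y x))).
  by have [] := is_derive_radial i (dG (sqdist_ge0 y x)).
split=> // [j x _|j x _].
  by have [] := is_derive_partial_radial i j x.
have -> : partial j (partial i f) = fun x => 2 * G' (sqdist y x) *+ (i == j) +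
     4 * G'' (sqdist y x) * ((x 0 i - y 0 i) * (x 0 j - y 0 j)).
  apply/funext => z; rewrite /partial.
  by have [] := is_derive_partial_radial i j z.
have -> : (fun x : 'rV[R]_n => 2 * G' (sqdist y x) *+ (i == j) +
     4 * G'' (sqdist y x) * ((x 0 i - y 0 i) * (x 0 j - y 0 j))) =
     (fun x => 2 *+ (i == j) * G' (sqdist y x) +
     4 * G'' (sqdist y x) * ((x 0 i - y 0 i) * (x 0 j - y 0 j))).
  apply/funext => z; congr (_ + _).
  by case: (i == j); rewrite ?mulr1n // !mulr0n mul0r.
apply: continuousD.
  apply: (@continuousM _ _ (cst (2 *+ (i == j)))); first exact: cst_continuous.
  exact: continuous_comp_sqdist (is_derive_continuous (dG' (sqdist_ge0 y x))).
apply: continuousM; last by apply: continuousM; exact: ccoord.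
apply: (@continuousM _ _ (cst 4)); first exact: cst_continuous.
exact: continuous_comp_sqdist (cG'' (sqdist_ge0 y x)).
Qed.

End radial.

(** * Semicontinuity, compactness and Euclidean balls *)

(** Without a maximum, the sets where [w < w b], for [b] in [A], form a directed relatively open
    cover of [A]; by compactness one of them is all of [A], yet it misses its own [b]. *)
Lemma usc_compact_max (R : realType) (X : topologicalType) (A : set X)
    (w : X -> R) :
  compact A -> A !=set0 ->
  (forall x, A x -> forall a, w x < a -> \forall y \near x, A y -> w y < a) ->
  exists2 x, A x & forall y, A y -> w y <= w x.
Proof.
move=> cA [x0 Ax0] uscw; apply: contrapT => nmax.
have larger x : A x -> exists2 y, A y & w x < w y.
  move=> Ax; apply: contrapT => nl; apply: nmax; exists x => // y Ay.
  by rewrite leNgt; apply/negP => xy; apply: nl; exists y.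
pose F : set_system X := filter_from A (fun a => [set b | A b /\ w a <= w b]).
have FF : Filter F.
  apply: filter_from_filter; first by exists x0.
  move=> a b Aa Ab; case: (leP (w a) (w b)) => ab; [exists b|exists a] => // c /=.
    by move=> [Ac bc]; split; split => //; exact: le_trans bc.
  by move=> [Ac ac]; split; split => //; apply: le_trans ac; exact: ltW.
have /compact_near_coveringP/near_covering_withinP cov := cA.
have : \near F, A `<=` (fun x => w x < w F).
  apply: cov => x Ax; have [y Ay xy] := larger x Ax.
  exists ([set z | A z -> w z < w y], [set b | A b /\ w y <= w b]) => /=.
    by split; [exact: uscw|exists y].
  by move=> [z b] /= [zy [Ab yb]] /zy /lt_le_trans; apply.
move=> [a Aa Ha]; have := Ha a (conj Aa (lexx _)) a Aa.
by rewrite ltxx.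
Qed.

Lemma sqr_coord_le_sqdist (R : realType) (n : nat) (y x : 'rV[R]_n) (i : 'I_n) :
  (x 0 i - y 0 i) ^+ 2 <= sqdist y x.
Proof.
by rewrite /sqdist (bigD1 i)//= lerDl; apply: sumr_ge0 => j _; exact: sqr_ge0.
Qed.

Lemma sqdist_le_coord (R : realType) (n : nat) (y x : 'rV[R]_n) (r : R) (i : 'I_n) :
  0 <= r -> sqdist y x <= r ^+ 2 -> `|x 0 i - y 0 i| <= r.
Proof.
move=> r0 /(le_trans (sqr_coord_le_sqdist y x i)).
by rewrite -real_normK ?num_real// ler_sqr.
Qed.

Lemma sqdistxx (R : realType) (n : nat) (x : 'rV[R]_n) : sqdist x x = 0.
Proof. by apply: big1 => i _; rewrite subrr expr0n. Qed.

Lemma sqdistC (R : realType) (n : nat) (x y : 'rV[R]_n) : sqdist x y = sqdist y x.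
Proof. by apply: eq_bigr => i _; rewrite -sqrrN opprB. Qed.

Lemma compact_annulus (R : realType) (n : nat) (y : 'rV[R]_n) (a r : R) :
  0 <= r -> compact [set x | a <= sqdist y x <= r ^+ 2].
Proof.
move=> r0.
(* The annulus is a closed subset of a product of segments. *)
have cbox := @rV_compact R n (fun i => `[y 0 i - r, y 0 i + r]%classic)
  (fun i => @segment_compact _ _ _).
apply: subclosed_compact cbox _ => [|x /= /andP[_ xr] i].
  have -> : [set x | a <= sqdist y x <= r ^+ 2] =
      sqdist y @^-1` `[a, r ^+ 2]%classic.
    by apply/seteqP; split => x /=; rewrite in_itv.
  apply: closed_comp; last exact: itv_closed.
  by move=> x _; exact: sqdist_continuous.
rewrite in_itv/=; have := sqdist_le_coord i r0 xr.
by rewrite ler_norml => /andP[h1 h2]; apply/andP; split; lra.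
Qed.

(** Neighbourhoods are given by sup-norm balls, which contain Euclidean ones; halving the radius
    turns a closed ball into part of an open one. *)
Lemma nbhs_sqdist_le (R : realType) (n : nat) (y : 'rV[R]_n) (P : set 'rV[R]_n) :
  nbhs y P -> exists2 a : R, 0 < a & forall x, sqdist y x <= a -> P x.
Proof.
move=> /nbhs_ballP[e e0 yP]; have e2 : 0 < e / 2 by rewrite divr_gt0.
exists ((e / 2) ^+ 2) => [|x xe]; first by rewrite exprn_gt0.
apply: yP; split => // i j; rewrite ord1 /ball/= distrC.
by apply: le_lt_trans (sqdist_le_coord j (ltW e2) xe) _; rewrite /= in e0; lra.
Qed.

Lemma enorm_scale_sub (R : realType) (n : nat) (y x : 'rV[R]_n) (c t : R) :
  0 <= t -> c ^+ 2 * sqdist y x <= t ^+ 2 -> enorm (c *: (x - y)) <= t.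
Proof.
move=> t0 ct; rewrite /enorm -(ger0_norm t0) -sqrtr_sqr ler_sqrt ?sqr_ge0//.
apply: le_trans ct; rewrite /sqdist mulr_sumr; apply: ler_sum => i _.
by rewrite !mxE exprMn.
Qed.

Lemma mul_sub_tr (R : realType) (n : nat) (y x : 'rV[R]_n) :
  ((x - y) *m (x - y)^T) 0 0 = sqdist y x.
Proof. by rewrite mxE; apply: eq_bigr => i _; rewrite !mxE expr2. Qed.

Lemma usc_sub_continuous (R : realType) (X : topologicalType) (A : set X)
    (u v : X -> R) (x : X) :
  (forall a, u x < a -> \forall y \near x, A y -> u y < a) ->
  {for x, continuous v} ->
  forall a, u x - v x < a -> \forall y \near x, A y -> u y - v y < a.
Proof.
move=> uscu cv a uva; pose e := (a - (u x - v x)) / 2.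
have e0 : 0 < e by rewrite /e; lra.
have un : \forall y \near x, A y -> u y < u x + e by apply: uscu; lra.
have vn : \forall y \near x, `|v x - v y| < e.
  by move/cvgrPdist_lt : cv; apply.
apply: filterS2 un vn => y h1 h2 /h1 {}h1.
by move: h2; rewrite ltr_norml => /andP[_ h2]; rewrite /e in h1 h2; lra.
Qed.

(** * The barrier and the local comparison argument *)

(** [H] is the solution [T] run at speed [K] from a late time [d], and [G] is its primitive divided
    by [kappa]. Starting late makes [H] uniformly small, hence [G] flat enough to lose less than
    [M - m0] between [s1] and [s0]. *)
Lemma barrier (R : realType) (phi : R -> R) (M m0 s0 s1 kappa K : R) :
  (forall t : R, 0 < t -> 0 < phi t) ->
  (forall t : R, 0 < t -> {for t, continuous phi}) ->
  (\int[lebesgue_measure]_(t in `]0%R, 1%R]) ((phi t)^-1)%:E = +oo)%E ->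
  m0 < M -> 0 < s0 -> s0 < s1 -> 0 < kappa -> 0 < K ->
  exists G H : R -> R,
    [/\ forall s : R, 0 <= s -> [/\ 0 < H s, is_derive s 1 G (H s / kappa) &
                             is_derive s 1 H (- K * phi (H s))],
        forall s t, 0 < s -> s < t -> G s < G t,
        G s1 = M & m0 < G s0].
Proof.
move=> phi_gt0 cphi phi_oo m0M s00 s01 k0 K0.
have [T [A [c [TA Tsmall]]]] := osgood_ode phi_gt0 cphi phi_oo.
pose e := (M - m0) * kappa / s1.
have s10 : 0 < s1 by exact: lt_trans s01.
have e0 : 0 < e by rewrite divr_gt0// mulr_gt0// subr_gt0.
have [d cd Td] := Tsmall e e0.
pose l (s : R) := K * s + d.
have dl (s : R) : is_derive s 1 l K by exact: is_derive_affine.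
have dls s : 0 <= s -> d <= l s by move=> s_0; rewrite /l lerDr mulr_ge0// ltW.
pose H s := T (l s).
(* Subtracting [A (l s1)] normalises [G s1 = M]; the factor [K] in the denominator cancels the
   derivative of [l]. *)
pose G s := M + (A (l s) - A (l s1)) / (kappa * K).
have GH (s : R) : 0 <= s -> [/\ 0 < H s, H s < e, is_derive s 1 G (H s / kappa) &
                             is_derive s 1 H (- K * phi (H s))].
  move=> s_0; have ds := dls s s_0; have [T0 dT dA] := TA _ (lt_le_trans cd ds).
  split => //; first exact: Td.
    have d1 := @is_derive1_comp _ A l s _ _ dA (dl s).
    have := is_derive1_comp (is_derive_affine (kappa * K)^-1
      (M - A (l s1) / (kappa * K)) (A (l s))) d1.
    have -> : (kappa * K)^-1 * (T (l s) * K) = H s / kappa.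
      by rewrite /H; field; rewrite !gt_eqF.
    by congr is_derive; apply/funext => z; rewrite /G /=; ring.
  have d2 := @is_derive1_comp _ T l s _ _ dT (dl s).
  by rewrite mulNr [K * _]mulrC -mulNr.
have G_lt s t : 0 < s -> s < t -> G s < G t.
  move=> s_0 st; apply: (@gt0_is_derive_lt _ G (fun s => H s / kappa) 0 (t + 1)) => //.
    move=> x /ltW x0 _; have [Hx _ dG _] := GH x x0.
    by split => //; rewrite divr_gt0.
  by rewrite ltrDl.
exists G, H; split => //.
- by move=> s s_0; have [] := GH s s_0.
- by rewrite /G subrr mul0r addr0.
(* By the mean value theorem the increment is below [e / kappa * (s1 - s0)], and
   [e / kappa * s1 = M - m0] by the choice of [e]. *)
have [||x] := @MVT _ G (fun s => H s / kappa) _ _ s01.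
- move=> x; rewrite in_itv/= => /andP[/(lt_trans s00)/ltW x0 _].
  by have [] := GH x x0.
- apply: continuous_in_within => x; rewrite in_itv/=.
  move=> /andP[/(lt_le_trans s00)/ltW x0 _].
  by have [_ _ dG _] := GH x x0; exact: is_derive_continuous dG.
rewrite in_itv/= => /andP[/(lt_trans s00)/ltW x0 _] GE.
have [Hx Hxe _ _] := GH x x0.
have Gs1 : G s1 = M by rewrite /G subrr mul0r addr0.
suff : H x / kappa * (s1 - s0) < M - m0 by rewrite -GE Gs1; lra.
have -> : M - m0 = e / kappa * s1 by rewrite /e; field; rewrite !gt_eqF.
apply: ltr_pM; rewrite ?ltr_pM2r ?invr_gt0//.
- by rewrite divr_ge0// ltW.
- by rewrite subr_ge0 ltW.
- by rewrite ltrBlDr ltrDl.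
Qed.

(* With G'(s) = t / kappa and G''(s) = - K p / kappa, where t = H(s) and
   p = phi(t), the Hessian of x |-> G(|x - y|^2) has eigenvalues a (m times)
   and a + b s. *)
Lemma supersolution_arith (R : realType) (lambda Lambda kappa s0 s t p K : R)
    (m : nat) :
  0 < lambda -> 0 < kappa -> 0 <= Lambda -> 0 < s0 -> s0 <= s -> 0 < t -> t <= p ->
  K = (kappa + 2 * (Lambda *+ m + lambda) + 1) / (4 * lambda * s0) ->
  let a := 2 * (t / kappa) in let b := 4 * (- K * p / kappa) in
  a + b * s < 0 /\ p < - (Lambda * a *+ m) - lambda * (a + b * s).
Proof.
move=> l0 k0 L0 s00 s0s t0 tp KE a b.
have Lm0 : 0 <= Lambda *+ m by rewrite mulrn_wge0.
have K0 : 0 < K by rewrite KE divr_gt0 ?mulr_gt0//; lra.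
have p0 : 0 < p by exact: lt_le_trans tp.
have KE' : 4 * lambda * K * s0 = kappa + 2 * (Lambda *+ m + lambda) + 1.
  by rewrite KE; field; rewrite !gt_eqF.
(* After multiplication by [kappa], the summand [kappa] of [K] absorbs [p], the summand
   [2 * (Lambda *+ m + lambda)] absorbs the terms in [t <= p], and 1 gives strictness. *)
have Ks : (kappa + 2 * (Lambda *+ m + lambda) + 1) * p <= 4 * lambda * K * s * p.
  by rewrite ler_pM2r// -KE' ler_pM2l// !mulr_gt0.
have Lt : (Lambda *+ m + lambda) * t <= (Lambda *+ m + lambda) * p.
  by rewrite ler_wpM2l// addr_ge0// ltW.
set Lm := Lambda *+ m in Lm0 KE' Ks Lt *.
have lt_ : lambda * t <= lambda * p by rewrite ler_wpM2l// ltW.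
have Lp0 : 0 <= Lm * p by rewrite mulr_ge0// ltW.
have kp0 : 0 <= kappa * p by rewrite mulr_ge0// ltW.
have lp0 : 0 < lambda * p by rewrite mulr_gt0.
split.
  rewrite -(pmulr_rlt0 _ l0) -(pmulr_rlt0 _ k0).
  have -> : kappa * (lambda * (a + b * s)) = 2 * (lambda * t) - 4 * lambda * K * s * p.
    by rewrite /a /b; field; rewrite gt_eqF.
  lra.
rewrite -(ltr_pM2l k0).
have -> : kappa * (- (Lambda * a *+ m) - lambda * (a + b * s)) =
   4 * lambda * K * s * p - 2 * ((Lm + lambda) * t).
  by rewrite -mulrnAl -/Lm /a /b; field; rewrite gt_eqF.
lra.
Qed.

(* y need not be the centre of a ball touching {u = M}: flatness of the barrier
   makes any y close to x1 work. *)
Lemma max_spreads (R : realType) (n : nat) (lambda Lambda : R) (phi : R -> R)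
    (F : 'rV[R]_n -> R -> 'rV[R]_n -> 'M[R]_n -> R)
    (Omega : set 'rV[R]_n) (u : 'rV[R]_n -> R) (M r : R) (y x1 : 'rV[R]_n) :
  0 < lambda -> lambda <= Lambda ->
  (forall s t : R, 0 <= s -> s < t -> phi s < phi t) ->
  (forall t : R, 0 < t -> {for t, continuous phi}) ->
  (forall t : R, 0 <= t -> t <= phi t) ->
  (\int[lebesgue_measure]_(t in `]0%R, 1%R]) ((phi t)^-1)%:E = +oo)%E ->
  degenerate_elliptic F ->
  (forall (x p : 'rV[R]_n) (X : 'M[R]_n), X \is symmetricmx ->
    - F x 0 p X <= phi (enorm p) - pucci_minus lambda Lambda X) ->
  viscosity_subsolution F Omega u ->
  (forall x, Omega x -> u x <= M) -> 0 < M ->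
  0 < r -> (forall x, sqdist y x <= r ^+ 2 -> Omega x) ->
  sqdist y x1 < r ^+ 2 -> u x1 = M -> M <= u y.
Proof.
(* In dimension 0 all points coincide, so [u y = M]; otherwise the dimension is [m.+1], with one
   radial and [m] tangential directions. *)
case: n F Omega u y x1 => [|m] F Omega u y x1.
  by do 14! move=> _; rewrite [y]thinmx0 [x1]thinmx0 => ->.
move=> l0 lL phi_incr cphi phi_ge phi_oo ellF F_ge [uscu subu] uM M0 r0 ballO x1r ux1.
rewrite leNgt; apply/negP => uyM.
have phi_gt0 (t : R) : 0 < t -> 0 < phi t.
  by move=> t0; apply: lt_le_trans (phi_ge _ (ltW t0)).
(* Staying above 0 as well as [u y] makes the barrier positive on the annulus. *)
pose m0 := (Num.max (u y) 0 + M) / 2.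
have [uym0 m00 m0M] : [/\ u y < m0, 0 < m0 & m0 < M].
  by rewrite /m0 maxEle; case: ifP => h; split; lra.
have Oy : Omega y by apply: ballO; rewrite sqdistxx sqr_ge0.
have [s0 s00 us0] := nbhs_sqdist_le (uscu y Oy m0 uym0).
pose s1 := sqdist y x1.
have s01 : s0 < s1.
  rewrite ltNge; apply/negP => /us0 ux1m0.
  by have := ux1m0 (ballO _ (ltW x1r)); lra.
(* With this [kappa], the gradient norm [2 * H s / kappa * |x - y|] is at most [H s] when
   [|x - y| <= r]. *)
pose kappa := 2 * r.
have k0 : 0 < kappa by rewrite mulr_gt0.
have L0 : 0 <= Lambda by rewrite ltW// (lt_le_trans l0).
have [K [K0 KE]] : exists K, 0 < K /\
    K = (kappa + 2 * (Lambda *+ m + lambda) + 1) / (4 * lambda * s0).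
  eexists; split; last by [].
  have Lm0 : 0 <= Lambda *+ m by rewrite mulrn_wge0.
  by rewrite divr_gt0 ?mulr_gt0//; lra.
have [G [H [GH G_lt Gs1 Gs0]]] := barrier phi_gt0 cphi phi_oo m0M s00 s01 k0 K0.
have cG (x : 'rV[R]_m.+1) : {for x, continuous (fun x => G (sqdist y x))}.
  apply: continuous_comp_sqdist.
  by have [_ dG _] := GH _ (sqdist_ge0 y x); exact: is_derive_continuous dG.
have [||x2 /= /andP[x2s0 x2r] x2max] := @usc_compact_max _ _ _
    (fun x => u x - G (sqdist y x)) (@compact_annulus _ _ y s0 _ (ltW r0)).
- by exists x1; rewrite /= !ltW.
- move=> x /= /andP[_ xr]; apply: usc_sub_continuous (cG x) => a uxa.
  apply: filterS (uscu x (ballO _ xr) a uxa) => z uza /andP[_ zr].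
  exact/uza/ballO.
have G_le s t : 0 < s -> s <= t -> G s <= G t.
  by move=> s_0; rewrite le_eqVlt => /predU1P[->//|/(G_lt _ _ s_0)/ltW].
(* Compare with [x1], which lies in the annulus and where [u] equals the barrier. *)
have ux2 : G (sqdist y x2) <= u x2.
  have := x2max x1; rewrite ux1 Gs1 subrr subr_ge0; apply.
  by rewrite /= !ltW.
have Ox2 := ballO _ x2r.
(* On the inner sphere [u < m0 < G s0], against [ux2]. *)
have x2s0' : s0 < sqdist y x2.
  rewrite lt_neqAle x2s0 andbT; apply/eqP => E.
  by have := us0 x2; rewrite -E lexx => /(_ isT Ox2); rewrite -E in ux2; lra.
(* On the outer sphere the barrier exceeds [G s1 = M], hence [u], again against [ux2]. *)
have x2r' : sqdist y x2 < r ^+ 2.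
  rewrite lt_neqAle x2r andbT; apply/eqP => E.
  have := G_lt s1 (r ^+ 2) (lt_trans s00 s01) x1r.
  by have := uM x2 Ox2; rewrite E in ux2; lra.
pose G' s := H s / kappa; pose G'' s := - K * phi (H s) / kappa.
have dG' (s : R) : 0 <= s -> is_derive s 1 G' (G'' s).
  move=> s_0; have [_ _ dH] := GH s s_0.
  have -> : G' = kappa^-1 *: H by apply/funext => z; rewrite /G' mulrC.
  by apply: is_derive_eq; rewrite /GRing.scale/= mulrC.
have cG'' (s : R) : 0 <= s -> {for s, continuous G''}.
  move=> s_0; have [Hs _ dH] := GH s s_0.
  have cH : {for s, continuous (fun s => phi (H s))}.
    apply: (@continuous_comp _ _ _ H phi); first exact: is_derive_continuous dH.
    exact: cphi.
  apply: (@continuousM _ _ _ (cst kappa^-1)); last exact: cst_continuous.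
  by apply: (@continuousM _ _ (cst (- K))); first exact: cst_continuous.
have dG (s : R) : 0 <= s -> is_derive s 1 G (G' s).
  by move=> s_0; have [] := GH s s_0.
have locmax : local_max_on Omega (fun x => u x - G (sqdist y x)) x2.
  have n1 : \forall x \near x2, s0 < sqdist y x.
    exact: (@sqdist_continuous _ _ y x2 _ (lt_nbhsr x2s0')).
  have n2 : \forall x \near x2, sqdist y x < r ^+ 2.
    exact: (@sqdist_continuous _ _ y x2 _ (lt_nbhsl x2r')).
  by apply: filterS2 n1 n2 => x xs0 xr _; apply: x2max; rewrite /= !ltW.
have := subu _ x2 (C2_radial y dG dG' cG'' Omega) Ox2 locmax.
rewrite (grad_radial y dG) (hessian_radial y dG dG').
set s := sqdist y x2 in x2s0 x2s0' x2r x2r' ux2 *.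
have s_0 : 0 <= s by exact: sqdist_ge0.
have [Hs _ _] := GH s s_0.
set p := _ *: _; set X := _ + _.
have symX : X \is symmetricmx.
  exact: symmetric_scalar_rank1.
move=> Fle.
(* Since [u x2 >= G s >= G s0 > 0], monotonicity in the second argument lowers [u x2] to 0, where
   the structure condition applies. *)
have Fle0 : F x2 0 p X <= 0.
  apply: le_trans Fle; apply: ellF => //.
    by apply: le_trans ux2; apply/ltW/(lt_trans m00)/(lt_le_trans Gs0)/G_le/ltW.
  by move=> v; rewrite subrr mulmx0 mul0mx mxE.
have pH : enorm p <= H s.
  apply: enorm_scale_sub; first exact: ltW.
  rewrite -/s /G' /kappa (_ : 2 * (H s / (2 * r)) = H s / r); last first.
    by field; rewrite !gt_eqF.
  by rewrite exprMn exprVn -mulrA ger_pMr ?exprn_gt0// ler_pdivrMl ?exprn_gt0// mulr1.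
have phip : phi (enorm p) <= phi (H s).
  move: pH; rewrite le_eqVlt => /predU1P[->//|pH].
  by apply/ltW/phi_incr => //; exact: sqrtr_ge0.
have [ab0 supersol] := supersolution_arith l0 k0 L0 s00 x2s0 Hs (phi_ge _ (ltW Hs)) KE.
(* The structure condition bounds the Pucci value of [X] by [phi (enorm p) <= phi (H s)], whereas
   [supersol] says it is strictly larger than [phi (H s)]. *)
have := F_ge x2 p X symX.
rewrite /X pucci_minus_rank1 ?mul_sub_tr//; first by rewrite -/X -/s /G' /G''; lra.
by rewrite mulr_ge0// divr_ge0// ltW.
Qed.

(** * From local spreading to constancy by connectedness *)

Theorem theorem1 (R : realType) (n : nat) (lambda Lambda : R) (phi : R -> R)
    (F : 'rV[R]_n -> R -> 'rV[R]_n -> 'M[R]_n -> R)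
    (Omega : set 'rV[R]_n) (u : 'rV[R]_n -> R) :
  0 < lambda -> lambda <= Lambda ->
  (forall t : R, 0 <= t -> 0 <= phi t) ->
  (forall s t : R, 0 <= s -> s < t -> phi s < phi t) ->
  {within `[0, +oo[, continuous phi} ->
  (forall t : R, 0 <= t -> t <= phi t) ->
  (\int[lebesgue_measure]_(t in `]0%R, 1%R]) ((phi t)^-1)%:E = +oo)%E ->
  degenerate_elliptic F ->
  (forall (x p : 'rV[R]_n) (X : 'M[R]_n), X \is symmetricmx ->
    - F x 0 p X <= phi (enorm p) - pucci_minus lambda Lambda X) ->
  open Omega -> connected Omega ->
  viscosity_subsolution F Omega u ->
  (exists x0 : 'rV[R]_n,
    [/\ Omega x0, 0 < u x0 & forall x, Omega x -> u x <= u x0]) ->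
  exists c : R, forall x, Omega x -> u x = c.
Proof.
move=> l0 lL phi_ge0 phi_incr phi_cont phi_ge phi_oo ellF F_ge openO connO subu.
move=> [x0 [Ox0 M0 uM]]; set M := u x0 in M0 uM; exists M.
have cphi (t : R) : 0 < t -> {for t, continuous phi}.
  have /continuous_within_itvcyP[cphi _] := phi_cont.
  by move=> t0; apply: cphi; rewrite in_itv/= t0.
have Z_open : open [set x | Omega x /\ u x = M].
  rewrite openE => x1 [Ox1 ux1]; rewrite /interior.
  have /nbhs_ballP[e /= e0 ballO] : nbhs x1 Omega by exact: open_nbhs_nbhs.
  have e2 : 0 < e / 2 by rewrite divr_gt0.
  have near_ball : \forall y \near x1, ball x1 (e / 2) y by exact: nbhsx_ballx.
  have near_sqdist : \forall y \near x1, sqdist x1 y < (e / 2) ^+ 2.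
    apply: (@sqdist_continuous _ _ x1 x1 _ (lt_nbhsl _)).
    by rewrite sqdistxx exprn_gt0.
  apply: filterS2 near_ball near_sqdist => y x1y x1y'.
  have Oy : Omega y.
    by apply: ballO; apply: le_ball x1y; lra.
  split=> //; apply/eqP; rewrite eq_le uM//=.
  (* Centre [y] and radius [e / 2]: the Euclidean ball contains [x1] and, by the triangle
     inequality, stays in the sup-norm ball of radius [e] about [x1]. *)
  apply: (max_spreads l0 lL phi_incr cphi phi_ge phi_oo ellF F_ge subu uM M0 e2
    _ _ ux1); last by rewrite sqdistC.
  move=> x yx; apply: ballO; case: x1y => _ x1y; split => // i j.
  have := x1y i j; rewrite ord1 /ball/= => h1; have h2 := sqdist_le_coord j (ltW e2) yx.
  rewrite distrC in h2.
  by have := ler_distD (y 0 j) (x1 0 j) (x 0 j); lra.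
(* Upper semicontinuity makes this set open, so the maximum set is relatively closed in [Omega]. *)
have lt_open : open [set x | Omega x /\ u x < M].
  rewrite openE => x [Ox uxM]; rewrite /interior; case: subu => uscu _.
  have nO : nbhs x Omega by exact: open_nbhs_nbhs.
  by apply: filterS2 nO (uscu x Ox M uxM) => y Oy /(_ Oy).
have ZE : [set x | Omega x /\ u x = M] = Omega.
  apply: connO.
  - by exists x0.
  - exists [set x | Omega x /\ u x = M] => //.
    by apply/seteqP; split => [x [Ox uxM]|x [Ox [_ uxM]]].
  - exists (~` [set x | Omega x /\ u x < M]); first exact: open_closedC.
    apply/seteqP; split => [x [Ox uxM]|x [Ox nux]].
      by split => // -[_]; rewrite uxM ltxx.
    split=> //; apply/eqP; rewrite eq_le uM//= leNgt; apply/negP => uxM.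
    exact: nux.
by move=> x; rewrite -[in Omega x]ZE => -[].
Qed.
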